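(* Let $0<\lambda\le 3$, $\mu>0$, $\nu\ge 1$ be real numbers. Let $T$ be the piecewise fractional linear map of $[0,1]$ with the three inverse branches $V_\lambda,V_\mu,V_\nu$, and let $S_{123}$ be the one with inverse branches $W_\lambda,W_\mu,W_\nu$, where $$V_\lambda(x)=\frac{\lambda x}{3+(3\lambda-3)x},\quad V_\mu(x)=\frac{3+(2\mu-3)x}{9+(3\mu-9)x},\quad V_\nu(x)=\frac{2+(\nu-2)x}{3+(\nu-3)x},$$ $$W_\lambda(x)=\frac{\lambda-\lambda x}{3\lambda+(3-3\lambda)x},\quad W_\mu(x)=\frac{2\mu+(3-2\mu)x}{3\mu+(9-3\mu)x},\quad W_\nu(x)=\frac{\nu+(2-\nu)x}{\nu+(3-\nu)x}.$$ Then $T$ has a natural dual if and only if $\lambda\mu+\mu=\lambda\nu+3\lambda$, and $S_{123}$ has a natural dual if and only if $\lambda\mu-4\lambda\nu+\mu\nu-3\lambda+4\mu-3\nu=0$. If both of these conditions are satisfied, then $T$ and $S_{123}$ have the same invariant measure if and only if $\mu=3$ and $\lambda\nu=3$.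
   Context: The partition of $[0,1]$ is $0<\tfrac13<\tfrac23<1$. A map with inverse branches $X_1,X_2,X_3$ is the map $[0,1]\to[0,1]$ (defined up to the finitely many partition points) which on each of the intervals $]0,\tfrac13[$, $]\tfrac13,\tfrac23[$, $]\tfrac23,1[$ is the inverse of the branch $X_j$ mapping $]0,1[$ bijectively onto that interval. The branches satisfy $W_\bullet(x)=V_\bullet(1-x)$; $V_\lambda,W_\lambda$ map onto the first interval, $V_\mu,W_\mu$ onto the second, $V_\nu,W_\nu$ onto the third. Thus $S_{123}=1-T$ (every branch of $T$ is replaced by the corresponding branch of $1-T$). A fractional linear map $X(x)=\frac{c+dx}{a+bx}$ is associated with the matrix $\begin{pmatrix}a&b\\c&d\end{pmatrix}$, and its adjoint $X^*(y)=\frac{b+dy}{a+cy}$ with the transposed matrix. Natural dual: a map $R$ with inverse branches $X_1,X_2,X_3$ has a natural dual if there are real $A,B,D$, not all zero, such that $\psi(t)=\frac{B+Dt}{A+Bt}$ satisfies $\psi\circ X_j=X_j^*\circ\psi$ for all $j$ and $B^*=\psi([0,1])$ is an interval (an endpoint $+\infty$ is allowed) with $1+xy>0$ for all $x\in\,]0,1[$ and all finite $y\in B^*$. The dual map $R^*$ on $B^*$ is then the piecewise fractional linear map with inverse branches $X_j^*$. The degenerate case $AD=B^2$, in which $\psi$ is a constant $\xi$ and $B^*=\{\xi\}$ (''singular dual''), is included. The endpoints of $B^*$ are $\psi(0)=B/A$ and $\psi(1)=(B+D)/(A+B)$. Invariant measure: if $R$ has a natural dual on $B^*$, the function $h(x)=\int_{B^*}\frac{dy}{(1+xy)^2}$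 (respectively $h(x)=\frac1{(1+\xi x)^2}$ if $B^*=\{\xi\}$) is the density of the ($\sigma$-finite, possibly infinite) invariant measure of $R$, i.e. $h(x)=\sum_j h(X_j(x))\,|X_j'(x)|$ on $]0,1[$. Invariant measures are considered up to a positive multiplicative constant; two maps have the same invariant measure if these densities agree up to a positive constant factor. *)

(* Defs.v *)
(* MathComp / MathComp-Analysis. *)
From HB Require Import structures.
From mathcomp Require Import all_boot all_order all_algebra.
From mathcomp Require Import all_classical all_reals all_analysis.
From mathcomp Require Import ring.

Set Implicit Arguments.
Unset Strict Implicit.
Unset Printing Implicit Defensive.

Import Order.TTheory GRing.Theory Num.Theory.
Import numFieldNormedType.Exports.

Local Open Scope classical_set_scope.
Local Open Scope ring_scope.

Definition mx2 (R : realType) (a b c d : R) : 'M[R]_2 :=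
  \matrix_(i < 2, j < 2)
    if i == 0 then (if j == 0 then a else b) else (if j == 0 then c else d).

(* The fractional linear map x |-> (c + d x) / (a + b x) attached to
   (a b ; c d): the numerator is read off the second row. *)
Definition fl (R : realType) (M : 'M[R]_2) (x : R) : R :=
  (M 1 0 + M 1 1 * x) / (M 0 0 + M 0 1 * x).

(* The same map with values at its pole and at infinity. The projective line
   has a single point at infinity, encoded as +oo; no map below takes the
   value -oo. *)
Definition efl (R : realType) (M : 'M[R]_2) (y : \bar R) : \bar R :=
  match y with
  | r%:E => if M 0 0 + M 0 1 * r == 0 then +oo%E else (fl M r)%:E
  | _ => if M 0 1 == 0 then +oo%E else (M 1 1 / M 0 1)%:E
  end.

(* The j-th of the three open intervals of the partition 0 < 1/3 < 2/3 < 1. *)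
Definition cell (R : realType) (j : 'I_3) : set R :=
  `]j%:R / 3, j.+1%:R / 3[%classic.

(* T is the map with inverse branches X 0, X 1, X 2. Its values at the
   partition points are left unconstrained. *)
Definition inverse_branches (R : realType) (T : R -> R) (X : 'I_3 -> 'M[R]_2)
  : Prop :=
  forall j : 'I_3,
    set_bij `]0, 1[%classic (cell j) (fl (X j)) /\
    (forall x : R, 0 < x < 1 -> T (fl (X j) x) = x).

(* psi(t) = (B + D t) / (A + B t). If A D = B^2 it is the constant B / A, also
   at the t (if any) where numerator and denominator vanish together, so it is
   evaluated at t = 0 (at t = 0 both vanish only if A = B = 0, where psi is the
   constant infinity). *)
Definition psi (R : realType) (A B D : R) (t : R) : \bar R :=
  efl (mx2 A B B D) (if A * D == B ^+ 2 then 0 else t)%:E.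

Definition dual_set (R : realType) (A B D : R) : set (\bar R) :=
  psi A B D @` `[0, 1]%classic.

Definition is_einterval (R : realType) (E : set (\bar R)) : Prop :=
  forall u v, E u -> E v -> forall w, (u <= w <= v)%E -> E w.

Definition natural_dual (R : realType) (X : 'I_3 -> 'M[R]_2) (A B D : R)
  : Prop :=
  [/\ ~ [/\ A = 0, B = 0 & D = 0],
      (forall (j : 'I_3) (t : R), 0 < t < 1 ->
         psi A B D (fl (X j) t) = efl (X j)^T (psi A B D t)),
      is_einterval (dual_set A B D) &
      (forall x y : R, 0 < x < 1 -> dual_set A B D y%:E -> 0 < 1 + x * y)].

Definition has_natural_dual (R : realType) (T : R -> R) : Prop :=
  exists (X : 'I_3 -> 'M[R]_2) (A B D : R),
    inverse_branches T X /\ natural_dual X A B D.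

Definition dual_density (R : realType) (A B D : R) (x : R) : \bar R :=
  if A * D == B ^+ 2 then (1 / (1 + B / A * x) ^+ 2)%:E
  else (\int[lebesgue_measure]_(y in [set y : R | dual_set A B D y%:E])
          (1 / (1 + x * y) ^+ 2)%:E)%E.

(* h is the density, furnished by a natural dual, of the invariant measure
   of T. *)
Definition invariant_density (R : realType) (T : R -> R) (h : R -> \bar R)
  : Prop :=
  exists (X : 'I_3 -> 'M[R]_2) (A B D : R),
    [/\ inverse_branches T X, natural_dual X A B D & h = dual_density A B D].

Definition same_invariant_measure (R : realType) (T S : R -> R) : Prop :=
  exists h k : R -> \bar R,
    [/\ invariant_density T h, invariant_density S k &
        exists2 c : R, 0 < c &
          forall x : R, 0 < x < 1 -> h x = (c%:E * k x)%E].

Definition Vlambda (R : realType) (lambda : R) : 'M[R]_2 :=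
  mx2 3 (3 * lambda - 3)
      0 lambda.
Definition Vmu (R : realType) (mu : R) : 'M[R]_2 :=
  mx2 9 (3 * mu - 9)
      3 (2 * mu - 3).
Definition Vnu (R : realType) (nu : R) : 'M[R]_2 :=
  mx2 3 (nu - 3)
      2 (nu - 2).

Definition Wlambda (R : realType) (lambda : R) : 'M[R]_2 :=
  mx2 (3 * lambda) (3 - 3 * lambda)
      lambda       (- lambda).
Definition Wmu (R : realType) (mu : R) : 'M[R]_2 :=
  mx2 (3 * mu) (9 - 3 * mu)
      (2 * mu) (3 - 2 * mu).
Definition Wnu (R : realType) (nu : R) : 'M[R]_2 :=
  mx2 nu (3 - nu)
      nu (2 - nu).

Definition V (R : realType) (lambda mu nu : R) (j : 'I_3) : 'M[R]_2 :=
  tnth [tuple Vlambda lambda; Vmu mu; Vnu nu] j.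
Definition W (R : realType) (lambda mu nu : R) (j : 'I_3) : 'M[R]_2 :=
  tnth [tuple Wlambda lambda; Wmu mu; Wnu nu] j.

Lemma fl_mx2 (R : realType) (a b c d x : R) :
  fl (mx2 a b c d) x = (c + d * x) / (a + b * x).
Proof. by rewrite /fl !mxE. Qed.

Lemma VE (R : realType) (lambda mu nu x : R) :
  [/\ fl (V lambda mu nu 0) x = (lambda * x) / (3 + (3 * lambda - 3) * x),
      fl (V lambda mu nu 1) x =
        (3 + (2 * mu - 3) * x) / (9 + (3 * mu - 9) * x) &
      fl (V lambda mu nu 2) x = (2 + (nu - 2) * x) / (3 + (nu - 3) * x)].
Proof. by split; rewrite /V /= fl_mx2 // add0r. Qed.

Lemma WE (R : realType) (lambda mu nu x : R) :
  [/\ fl (W lambda mu nu 0) x =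
        (lambda - lambda * x) / (3 * lambda + (3 - 3 * lambda) * x),
      fl (W lambda mu nu 1) x =
        (2 * mu + (3 - 2 * mu) * x) / (3 * mu + (9 - 3 * mu) * x) &
      fl (W lambda mu nu 2) x = (nu + (2 - nu) * x) / (nu + (3 - nu) * x)].
Proof. by split; rewrite /W /= fl_mx2 // mulNr. Qed.

Lemma W_V (R : realType) (lambda mu nu x : R) (j : 'I_3) :
  fl (W lambda mu nu j) x = fl (V lambda mu nu j) (1 - x).
Proof.
have [V0 V1 V2] := VE lambda mu nu (1 - x).
have [W0 W1 W2] := WE lambda mu nu x.
case: j => [[|[|[|//]]] Hj].
- rewrite (_ : Ordinal Hj = 0) ?W0 ?V0; last exact/val_inj.
  by congr (_ / _); ring.
- rewrite (_ : Ordinal Hj = 1) ?W1 ?V1; last exact/val_inj.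
  by congr (_ / _); ring.
- rewrite (_ : Ordinal Hj = 2) ?W2 ?V2; last exact/val_inj.
  by congr (_ / _); ring.
Qed.

(* Main.v *)
(* Write psi as the symmetric matrix P = (A B ; B D). The relation
   psi o X = X^* o psi says that P X and its transpose act alike, which forces
   P X to be symmetric: otherwise 1 + t psi (X t) would vanish, against
   positivity. Symmetry is one linear equation in (A, B, D) per branch. For T
   and for S123 two of the three equations determine (A, B, D) up to scale, and
   the third one is the condition of the theorem; positivity of a bilinear form
   at the corners of the unit square shows that this solution is a natural
   dual. Its density is c / ((A + B x) (A + B + (B + D) x)), so the two
   invariant measures agree iff two quadratic polynomials are proportional. Both
   conditions together give (lambda nu - 3) (nu - 3 lambda) = 0, and
   proportionality with nu = 3 lambda forces lambda = 1. *)
Require Import Defs.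
From mathcomp Require Import all_boot all_order all_algebra.
From mathcomp Require Import all_classical all_reals all_analysis.
From mathcomp Require Import ring lra.

Set Implicit Arguments.
Unset Strict Implicit.

Import Order.TTheory GRing.Theory Num.Theory.
Import numFieldNormedType.Exports.

Local Open Scope ring_scope.

(** * Values of [psi], and invariance under scaling of (A, B, D) *)

Lemma efl_fin (R : realType) (M : 'M[R]_2) (y : R) :
  efl M y%:E = if M 0 0 + M 0 1 * y == 0 then +oo%E else (fl M y)%:E.
Proof. by []. Qed.

Lemma eflT_fin (R : realType) (M : 'M[R]_2) (p q : R) :
  p != 0 -> M 0 0 * p + M 1 0 * q != 0 ->
  efl M^T (q / p)%:E =
    ((M 0 1 * p + M 1 1 * q) / (M 0 0 * p + M 1 0 * q))%:E.
Proof.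
move=> p0 d0; rewrite efl_fin !mxE.
have E : M 0 0 + M 1 0 * (q / p) = (M 0 0 * p + M 1 0 * q) / p by field.
rewrite E mulf_eq0 invr_eq0 (negPf p0) (negPf d0) /= /fl !mxE E.
by congr (_%:E); field; rewrite p0 d0.
Qed.

Lemma psi_fin (R : realType) (A B D t : R) :
  A + B * t != 0 -> psi A B D t = ((B + D * t) / (A + B * t))%:E.
Proof.
move=> p0; rewrite /psi efl_fin fl_mx2 !mxE /=.
(* In the degenerate case [psi] is evaluated at 0; [A * D = B ^+ 2] makes the fraction at t equal to
   B / A by cross-multiplication. *)
have [e|_] := eqVneq (A * D) (B ^+ 2); last by rewrite (negPf p0).
rewrite !mulr0 !addr0; have [A0|A0] := eqVneq A 0.
  have B0 : B = 0 by apply/eqP; rewrite -sqrf_eq0 -e A0 mul0r.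
  by move: p0; rewrite A0 B0 mul0r addr0 eqxx.
congr (_%:E); apply/eqP; rewrite eqr_div //; apply/eqP.
by rewrite mulrDl mulrDr [D * t * A]mulrAC [D * A]mulrC e; ring.
Qed.

Lemma psi_pinfty (R : realType) (A B D t : R) :
  A * D != B ^+ 2 -> A + B * t = 0 -> psi A B D t = +oo%E.
Proof.
by move=> e p0; rewrite /psi (negPf e) efl_fin !mxE /= p0 eqxx.
Qed.

Lemma psi_degenerate (R : realType) (A B D t : R) :
  A * D = B ^+ 2 -> psi A B D t = if A == 0 then +oo%E else (B / A)%:E.
Proof.
by move=> e; rewrite /psi e eqxx efl_fin fl_mx2 !mxE /= !mulr0 !addr0.
Qed.

Lemma degenerate_scale (R : realType) (k A B D : R) :
  k != 0 -> (k * A * (k * D) == (k * B) ^+ 2) = (A * D == B ^+ 2).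
Proof.
move=> k0; have -> : k * A * (k * D) = k ^+ 2 * (A * D) by ring.
by rewrite exprMn; apply/inj_eq/mulfI; rewrite sqrf_eq0.
Qed.

Lemma psi_scale (R : realType) (k A B D t : R) :
  k != 0 -> psi (k * A) (k * B) (k * D) t = psi A B D t.
Proof.
move=> k0; rewrite /psi !efl_fin !fl_mx2 !mxE /=.
rewrite degenerate_scale //.
set s := (if _ then 0 else t).
rewrite -!mulrA -!mulrDr mulf_eq0 (negPf k0) /=.
by case: ifP => // _; rewrite -mulf_div divff // mul1r.
Qed.

Lemma dual_set_scale (R : realType) (k A B D : R) :
  k != 0 -> dual_set (k * A) (k * B) (k * D) = dual_set A B D.
Proof.
by move=> k0; rewrite /dual_set; congr image; apply/funext => t; rewrite psi_scale.
Qed.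

(** The symmetry equations fix (A, B, D) only up to a nonzero factor; this lets any solution be
    replaced by a normalized one. *)
Lemma dual_density_scale (R : realType) (k A B D : R) :
  k != 0 -> dual_density (k * A) (k * B) (k * D) = dual_density A B D.
Proof.
move=> k0; apply/funext => x; rewrite /dual_density dual_set_scale //.
rewrite degenerate_scale //.
by rewrite -(mulf_div k k) divff // (mul1r (B / A)).
Qed.


(** * Inverse branches: a map determines their matrices up to a factor *)

Lemma cell_sub01 (R : realType) (j : 'I_3) (x : R) : cell j x -> 0 < x < 1.
Proof.
rewrite /cell /= in_itv /= => /andP[h1 h2].
have j0 : 0 <= j%:R :> R by apply: ler0n.
have j3 : j.+1%:R <= 3 :> R by rewrite ler_nat.
by apply/andP; split; lra.
Qed.

Lemma branch_in01 (R : realType) (T : R -> R) (X : 'I_3 -> 'M[R]_2)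
  (j : 'I_3) (x : R) :
  inverse_branches T X -> 0 < x < 1 -> 0 < fl (X j) x < 1.
Proof.
move=> hX hx; apply: (@cell_sub01 _ j).
by have [[hf _ _] _] := hX j; apply: hf; rewrite /= in_itv.
Qed.

Lemma branch_den_neq0 (R : realType) (T : R -> R) (X : 'I_3 -> 'M[R]_2)
  (j : 'I_3) (x : R) :
  inverse_branches T X -> 0 < x < 1 -> X j 0 0 + X j 0 1 * x != 0.
Proof.
move=> hX hx; have := branch_in01 j hX hx; rewrite /fl.
(* At a pole the division returns 0, which lies outside the open unit interval. *)
by case: eqVneq => // ->; rewrite invr0 mulr0 ltxx.
Qed.

(** Surjectivity of the second branch onto the cell gives y with the same image, and applying T to
    both sides yields y = x. *)
Lemma branch_unique (R : realType) (T : R -> R) (X Y : 'I_3 -> 'M[R]_2)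
  (j : 'I_3) (x : R) :
  inverse_branches T X -> inverse_branches T Y -> 0 < x < 1 ->
  fl (X j) x = fl (Y j) x.
Proof.
move=> hX hY hx; have [[fX _ _] TX] := hX j; have [[_ _ sY] TY] := hY j.
have [|y /= + e] := sY (fl (X j) x); first by apply: fX; rewrite /= in_itv.
by rewrite in_itv /= => hy; rewrite -e -(TX _ hx) -{1}e TY.
Qed.

(** A singular matrix would give the same value at 1/2 and 1/3, against injectivity. *)
Lemma branch_det_neq0 (R : realType) (T : R -> R) (X : 'I_3 -> 'M[R]_2)
  (j : 'I_3) :
  inverse_branches T X -> X j 0 0 * X j 1 1 - X j 0 1 * X j 1 0 != 0.
Proof.
move=> hX; apply/eqP => d0.
have [[_ iX _] _] := hX j.
have h x : 0 < x < 1 -> X j 0 0 + X j 0 1 * x != 0 by apply: branch_den_neq0.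
have h1 : 0 < (1 / 2 : R) < 1 by apply/andP; split; lra.
have h2 : 0 < (1 / 3 : R) < 1 by apply/andP; split; lra.
suff : (1 / 2 : R) = 1 / 3 by lra.
apply: iX; rewrite ?inE ?mem_set //= ?in_itv //=.
apply/eqP; rewrite eqr_div ?h //; apply/eqP/eqP; rewrite -subr_eq0.
set a := X j 0 0 in d0 *; set b := X j 0 1 in d0 *.
set c := X j 1 0 in d0 *; set d := X j 1 1 in d0 *.
have -> : (c + d * (1 / 2)) * (a + b * (1 / 3))
   - (c + d * (1 / 3)) * (a + b * (1 / 2)) = (a * d - b * c) / 6 by field.
by rewrite d0 mul0r.
Qed.

Lemma quadratic_eq0 (R : realType) (u v w : R) :
  (forall x, 0 < x < 1 -> u + v * x + w * x ^+ 2 = 0) ->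
  [/\ u = 0, v = 0 & w = 0].
Proof.
move=> h.
have := h (1 / 2); have := h (1 / 3); have := h (2 / 3).
rewrite !expr2 => h1 h2 h3.
have {}h1 := h1 ltac:(apply/andP; split; lra).
have {}h2 := h2 ltac:(apply/andP; split; lra).
have {}h3 := h3 ltac:(apply/andP; split; lra).
by split; lra.
Qed.

(* P M is symmetric, where P = (A B ; B D). *)
Definition symmetrizes (R : realType) (A B D : R) (M : 'M[R]_2) : Prop :=
  A * M 0 1 + B * M 1 1 = B * M 0 0 + D * M 1 0.

(** A natural dual may use other matrices than those in the theorem. Equal fractional linear maps
    have proportional matrices, and the symmetry equation is homogeneous in the matrix. *)
Lemma symmetrizes_branch (R : realType) (T : R -> R) (X Y : 'I_3 -> 'M[R]_2)
  (A B D : R) (j : 'I_3) :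
  inverse_branches T X -> inverse_branches T Y ->
  symmetrizes A B D (X j) -> symmetrizes A B D (Y j).
Proof.
move=> hX hY; rewrite /symmetrizes.
have dX := branch_det_neq0 j hX.
have dY := branch_det_neq0 j hY.
have h x : 0 < x < 1 ->
    (X j 1 0 + X j 1 1 * x) * (Y j 0 0 + Y j 0 1 * x) =
    (Y j 1 0 + Y j 1 1 * x) * (X j 0 0 + X j 0 1 * x).
  move=> hx; apply/eqP; rewrite -eqr_div ?(branch_den_neq0 _ _ hx) //.
  - exact/eqP/(branch_unique j hX hY hx).
  - exact: branch_den_neq0 hX hx.
  - exact: branch_den_neq0 hY hx.
move: dX dY h.
set a := X j 0 0; set b := X j 0 1; set c := X j 1 0; set d := X j 1 1.
set a' := Y j 0 0; set b' := Y j 0 1; set c' := Y j 1 0; set d' := Y j 1 1.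
move=> dX dY h.
have [] := @quadratic_eq0 R (c * a' - c' * a)
  (c * b' + d * a' - c' * b - d' * a) (d * b' - d' * b).
  by move=> x /h /eqP; rewrite -subr_eq0 => /eqP <-; ring.
move=> e1 e2 e3 s.
(* The three coefficient identities say that adj(Y) X is k times the identity; multiplying by Y
   gives e X = k Y. *)
set k := a * d' - c * b'; set e := a' * d' - b' * c' in dY.
have ea : e * a = k * a'.
  by apply/eqP; rewrite -subr_eq0; apply/eqP; rewrite -[RHS](mulr0 b') -e1 /e /k; ring.
have eb : e * b = k * b'.
  by apply/eqP; rewrite -subr_eq0; apply/eqP;
    rewrite -[RHS](subrr 0) -{1}(mulr0 b') -{1}e2 -(mulr0 a') -e3 /e /k; ring.
have ec : e * c = k * c'.
  by apply/eqP; rewrite -subr_eq0; apply/eqP; rewrite -[RHS](mulr0 d') -e1 /e /k; ring.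
have ed : e * d = k * d'.
  by apply/eqP; rewrite -subr_eq0; apply/eqP;
    rewrite -[RHS](subrr 0) -{1}(mulr0 d') -{1}e2 -(mulr0 c') -e3 /e /k; ring.
have k0 : k != 0.
  apply: contraNneq dX => k0; move: ea eb; rewrite k0 !mul0r.
  move=> /eqP; rewrite mulf_eq0 (negPf dY) /= => /eqP ->.
  move=> /eqP; rewrite mulf_eq0 (negPf dY) /= => /eqP ->.
  by rewrite !mul0r subr0.
apply: (mulfI k0); rewrite !mulrDr ![k * (_ * _)]mulrCA -ea -eb -ec -ed.
by rewrite ![_ * (e * _)]mulrCA -!mulrDr s.
Qed.

(** * Necessity: a natural dual makes P X symmetric *)

Lemma psi_num_neq0 (R : realType) (A B D t : R) :
  A * D != B ^+ 2 -> A + B * t = 0 -> B + D * t != 0.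
Proof.
move=> e p0; apply: contraNneq e => q0; apply/eqP.
have -> : A = - (B * t) by lra.
rewrite expr2; have {3}-> : B = - (D * t) by lra.
by ring.
Qed.

(** The product form absorbs the poles: if one side of the relation is infinite, so is the other,
    and then both denominators [A + B * s] and [n0] vanish. *)
Lemma psi_eflT_cross (R : realType) (M : 'M[R]_2) (A B D s t : R) :
  A * D != B ^+ 2 -> psi A B D s = efl M^T (psi A B D t) ->
  (A + B * s) * (M 0 1 * (A + B * t) + M 1 1 * (B + D * t)) =
  (B + D * s) * (M 0 0 * (A + B * t) + M 1 0 * (B + D * t)).
Proof.
move=> e; set n0 := M 0 0 * _ + _; set n1 := M 0 1 * _ + _.
have -> : efl M^T (psi A B D t) = if n0 == 0 then +oo%E else (n1 / n0)%:E.
  have [r0|r0] := eqVneq (A + B * t) 0.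
    have z0 := psi_num_neq0 e r0.
    rewrite (psi_pinfty e r0) /efl !mxE /n0 /n1 r0 !mulr0 !add0r.
    by rewrite mulf_eq0 (negPf z0) orbF -mulf_div divff // mulr1.
  rewrite (psi_fin _ r0); case: ifPn => [/eqP h|]; last exact: eflT_fin.
  rewrite efl_fin !mxE; case: eqVneq => // /negP[]; apply/eqP.
  apply: (mulIf r0); rewrite mul0r -h /n0.
  by field.
have [p0|p0] := eqVneq (A + B * s) 0.
  rewrite (psi_pinfty e p0) p0 mul0r.
  by have [->|//] := eqVneq n0 0; rewrite mulr0.
rewrite (psi_fin _ p0); have [//|h] := eqVneq n0 0.
by case=> /eqP; rewrite eqr_div // mulrC => /eqP ->; rewrite mulrC.
Qed.

Lemma natural_dual_symmetrizes (R : realType) (T : R -> R)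
  (X : 'I_3 -> 'M[R]_2) (A B D : R) (j : 'I_3) :
  inverse_branches T X -> natural_dual X A B D -> symmetrizes A B D (X j).
Proof.
move=> hX [n0 hpsi _ hpos]; rewrite /symmetrizes.
have h2 : 0 < (1 / 2 : R) < 1 by apply/andP; split; lra.
(* A single interior point suffices, and 1/2 is an arbitrary choice. *)
move: (1 / 2) h2 => t ht.
have := hpsi j t ht; have := branch_den_neq0 j hX ht.
have hV := branch_in01 j hX ht.
have pos01 y : dual_set A B D y%:E -> 0 < 1 + t * y by apply: hpos.
have mem01 s : 0 < s < 1 -> dual_set A B D (psi A B D s).
  by move=> /andP[s0 s1]; exists s => //=; rewrite in_itv /= !ltW.
have := pos01 _; have := mem01 _ hV; move: hV; rewrite {1 2}/fl.
set a := X j 0 0; set b := X j 0 1; set c := X j 1 0; set d := X j 1 1.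
(* Here [psi] is a constant fixed by the dual branch. If it is finite, its fixed-point equation
   becomes the symmetry equation through D = B^2 / A; if it is infinite, then A = B = 0 and
   [c = 0]. *)
have [e|e] := eqVneq (A * D) (B ^+ 2).
  rewrite !psi_degenerate //.
  move=> _ _ _ _; have [A0|A0] := eqVneq A 0.
    have B0 : B = 0 by apply/eqP; rewrite -sqrf_eq0 -e A0 mul0r.
    rewrite /efl !mxE -/c; case: eqVneq => // -> _.
    by rewrite A0 B0 !mul0r mulr0 addr0.
  rewrite efl_fin !mxE -/a -/c /fl !mxE -/a -/b -/c -/d.
  case: eqVneq => // d0 [/eqP]; rewrite eq_sym eqr_div // => /eqP h.
  have d1 : A * a + B * c != 0.
    apply: contraNneq d0 => d1; apply/eqP/(mulfI A0); rewrite mulr0 -d1.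
    by field.
  apply: (mulfI A0).
  have -> : A * (A * b + B * d) = ((b + d * (B / A)) * A) * A by field.
  by rewrite h; have -> : D = B ^+ 2 / A; [rewrite -e; field | field].
move=> hV mem pos den eq_psi.
have := psi_eflT_cross e eq_psi.
move: hV mem; rewrite {eq_psi}; set s := _ / _ => hs mem.
(* Up to the factor a + b t this is the quadratic form of P X at (1, t). *)
have key : (A + B * s) + t * (B + D * s) != 0.
  have [p0|p0] := eqVneq (A + B * s) 0.
    rewrite p0 add0r mulf_neq0 ?(psi_num_neq0 e p0) //.
    by case/andP: ht => /lt0r_neq0.
  have := pos _ (eq_rect _ _ mem _ (psi_fin _ p0)).
  move=> /lt0r_neq0; apply: contraNneq => h; apply/eqP/(mulfI p0).
  by rewrite mulr0 -h; field.
have Es : (a + b * t) * s = c + d * t by rewrite /s mulrC divfK.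
move=> cross; apply: (mulIf key); apply: (mulfI den).
apply/eqP; rewrite -subr_eq0; apply/eqP.
(* With M = P X and v = (1, t), the cross product of M v and M^T v is the defect of symmetry times
   the quadratic form v^T M v. The relation makes the cross product zero, while [key] and [den] make
   the form nonzero. *)
transitivity ((a + b * t) *
  ((A + B * s) * (b * (A + B * t) + d * (B + D * t)) -
   (B + D * s) * (a * (A + B * t) + c * (B + D * t)))); last first.
  by rewrite cross subrr mulr0.
transitivity ((A * b + B * d - (B * a + D * c)) *
  (A * (a + b * t) + B * ((a + b * t) * s) +
   t * (B * (a + b * t) + D * ((a + b * t) * s)))); first by ring.
transitivity (
  (A * (a + b * t) + B * ((a + b * t) * s)) *
    (b * (A + B * t) + d * (B + D * t)) -
  (B * (a + b * t) + D * ((a + b * t) * s)) *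
    (a * (A + B * t) + c * (B + D * t))); last by ring.
by rewrite Es; ring.
Qed.

(** * Sufficiency: symmetry and positivity at the corners give a natural dual *)

Lemma affine_ge0 (R : realType) (u v t : R) :
  0 <= u -> 0 <= u + v -> 0 <= t <= 1 -> 0 <= u + v * t.
Proof.
move=> u0 v0 /andP[t0 t1].
have -> : u + v * t = (1 - t) * u + t * (u + v) by ring.
by rewrite addr_ge0 // mulr_ge0 // subr_ge0.
Qed.

(** The number 2 u + v is the sum of the two endpoint values, so its positivity says that they do
    not both vanish. *)
Lemma affine_gt0 (R : realType) (u v t : R) :
  0 <= u -> 0 <= u + v -> 0 < 2 * u + v -> 0 < t < 1 -> 0 < u + v * t.
Proof.
move=> u0 v0 uv /andP[t0 t1].
have -> : u + v * t = (1 - t) * u + t * (u + v) by ring.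
have [u00|u00] := eqVneq u 0.
  by rewrite u00 mulr0 !add0r mulr_gt0 //; lra.
rewrite ltr_wpDr //; first by rewrite mulr_ge0 // ltW.
by rewrite mulr_gt0 ?subr_gt0 // lt_def u00.
Qed.

(* The bilinear form A + B (x + t) + D x t, which is
   (A + B t) (1 + x * psi t), is nonnegative at the corners of the unit square and does
   not vanish identically on either of the sides t = 0 and t = 1. *)
Definition admissible (R : realType) (A B D : R) : Prop :=
  [/\ 0 <= A, 0 <= A + B, 0 <= A + 2 * B + D,
      0 < 2 * A + B & 0 < 2 * A + 3 * B + D].

Lemma admissible_sum_ge0 (R : realType) (A B D t : R) :
  admissible A B D -> 0 <= t <= 1 -> 0 <= (A + B * t) + (B + D * t).
Proof.
move=> [_ h1 h2 _ _] ht.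
have -> : (A + B * t) + (B + D * t) = (A + B) + (B + D) * t by ring.
by apply: affine_ge0 => //; lra.
Qed.

Lemma dual_set_finP (R : realType) (A B D y : R) :
  admissible A B D -> A * D != B ^+ 2 ->
  dual_set A B D y%:E <->
  exists2 t, 0 <= t <= 1 & B + D * t = y * (A + B * t).
Proof.
move=> adm e; split.
  move=> [t /=]; rewrite in_itv /= => ht.
  have [p0|p0] := eqVneq (A + B * t) 0; first by rewrite (psi_pinfty e p0).
  by rewrite (psi_fin _ p0) => -[<-]; exists t => //; rewrite divfK.
move=> [t ht h]; exists t; rewrite /= ?in_itv //=.
have p0 : A + B * t != 0.
  by apply/eqP => p0; have /eqP[] := psi_num_neq0 e p0; rewrite h p0 mulr0.
by rewrite (psi_fin _ p0) h mulfK.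
Qed.

(** For finite y between psi(s) and psi(t), the affine function r |-> B + D r - y (A + B r) changes
    sign between s and t, and its zero is a preimage of y. This covers both monotonicities of [psi]
    and a pole at an endpoint. *)
Lemma admissible_einterval (R : realType) (A B D : R) :
  admissible A B D -> is_einterval (dual_set A B D).
Proof.
move=> adm u v [s /= + <-] [t /= + <-] w /andP[].
rewrite !in_itv /= => hs ht.
have [e|e] := eqVneq (A * D) (B ^+ 2).
  rewrite !psi_degenerate // => w1 w2.
  have -> : w = if A == 0 then +oo%E else (B / A)%:E.
    by apply/eqP; rewrite eq_le w1 w2.
  by exists s; rewrite /= ?in_itv //= psi_degenerate.
have pge0 r : 0 <= r <= 1 -> 0 <= A + B * r.
  by case: adm => ? ? ? ? ?; apply: affine_ge0.
have qge0 r : 0 <= r <= 1 -> A + B * r = 0 -> 0 <= B + D * r.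
  by move=> hr p0; have := admissible_sum_ge0 adm hr; rewrite p0 add0r.
case: w => [y| |].
- move=> w1 w2; apply/(dual_set_finP _ adm e).
  have gs : B + D * s - y * (A + B * s) <= 0.
    have [p0|p0] := eqVneq (A + B * s) 0.
      by move: w1; rewrite (psi_pinfty e p0).
    move: w1; rewrite (psi_fin _ p0) lee_fin ler_pdivrMr ?subr_le0 //.
    by rewrite lt_def p0 pge0.
  have gt : 0 <= B + D * t - y * (A + B * t).
    have [p0|p0] := eqVneq (A + B * t) 0.
      by rewrite p0 mulr0 subr0 qge0.
    move: w2; rewrite (psi_fin _ p0) lee_fin ler_pdivlMr ?subr_ge0 //.
    by rewrite lt_def p0 pge0.
  have : exists2 r, 0 <= r <= 1 & B + D * r - y * (A + B * r) = 0.
    set gs' := B + _ - _ in gs; set gt' := B + _ - _ in gt.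
    have [g0|g0] := eqVneq (gt' - gs') 0.
      by exists s => //; rewrite -/gs'; lra.
    have g1 : 0 < gt' - gs' by rewrite lt_def g0; lra.
    (* The zero found by linear interpolation between s and t. *)
    exists ((s * gt' - t * gs') / (gt' - gs')).
      rewrite divr_ge0 ?(ltW g1) /= ?ler_pdivrMr ?mul1r //; move: hs ht; nra.
    move: g0; rewrite /gt' /gs' => g0; field; move: g0.
    by apply: contraNneq => <-; apply/eqP; ring.
  by move=> [r hr /eqP]; rewrite subr_eq0 => /eqP; exists r.
- rewrite leye_eq => _ /eqP h.
  by exists t; rewrite /= ?in_itv.
- rewrite leeNy_eq => /eqP h _.
  by exists s; rewrite /= ?in_itv.
Qed.

Lemma natural_dual_admissible (R : realType) (T : R -> R)
  (X : 'I_3 -> 'M[R]_2) (A B D : R) :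
  inverse_branches T X -> admissible A B D ->
  (forall j, symmetrizes A B D (X j)) -> natural_dual X A B D.
Proof.
move=> hX adm sym; have [h0 h1 h2 h3 h4] := adm.
have pgt0 r : 0 < r < 1 -> 0 < A + B * r by apply: affine_gt0.
split.
- by move=> [A0 B0 _]; move: h3; rewrite A0 B0 mulr0 addr0 ltxx.
- move=> j t ht; have hs := branch_in01 j hX ht.
  have den := branch_den_neq0 j hX ht.
  have p0 := lt0r_neq0 (pgt0 _ ht); have p1 := lt0r_neq0 (pgt0 _ hs).
  have Es : (X j 0 0 + X j 0 1 * t) * fl (X j) t = X j 1 0 + X j 1 1 * t.
    by rewrite /fl mulrC divfK.
  have S := sym j; rewrite /symmetrizes in S.
  (* [E0] and [E1] are the components of X^T P (1, t) = P X (1, t), where X (1, t) is a multiple of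
     (1, s) with s the image of t. *)
  have E0 : X j 0 0 * (A + B * t) + X j 1 0 * (B + D * t) =
      (X j 0 0 + X j 0 1 * t) * (A + B * fl (X j) t).
    rewrite [RHS]mulrDr [X in _ = _ + X]mulrCA Es.
    have -> : X j 0 0 * (A + B * t) + X j 1 0 * (B + D * t) =
      A * X j 0 0 + B * X j 1 0 + t * (B * X j 0 0 + D * X j 1 0) by ring.
    by rewrite -S; ring.
  have E1 : X j 0 1 * (A + B * t) + X j 1 1 * (B + D * t) =
      (X j 0 0 + X j 0 1 * t) * (B + D * fl (X j) t).
    rewrite [RHS]mulrDr [X in _ = _ + X]mulrCA Es.
    have -> : X j 0 1 * (A + B * t) + X j 1 1 * (B + D * t) =
      (A * X j 0 1 + B * X j 1 1) + t * (B * X j 0 1 + D * X j 1 1) by ring.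
    by rewrite S; ring.
  rewrite !psi_fin // eflT_fin //; last by rewrite E0 mulf_neq0.
  by rewrite E0 E1 -mulf_div divff // mul1r.
- exact: admissible_einterval.
- move=> x y hx [t /=]; rewrite in_itv /= => ht.
  have [p0|p0] := eqVneq (A + B * t) 0.
    have [e|e] := eqVneq (A * D) (B ^+ 2); last by rewrite (psi_pinfty e p0).
    have A0 : A != 0.
      apply: contraTneq h3 => A0.
      have -> : B = 0 by apply/eqP; rewrite -sqrf_eq0 -e A0 mul0r.
      by rewrite A0 mulr0 addr0 ltxx.
    rewrite psi_degenerate // (negPf A0) => -[<-].
    have -> : 1 + x * (B / A) = (A + B * x) / A by field.
    by rewrite divr_gt0 ?pgt0 // lt_def A0.
  rewrite psi_fin // => -[<-].
  have pt : 0 < A + B * t by rewrite lt_def p0 affine_ge0.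
  (* The numerator is affine in x, hence a convex combination of its values at x = 0 and x = 1. *)
  have -> : 1 + x * ((B + D * t) / (A + B * t)) =
    ((1 - x) * (A + B * t) + x * (A + B * t + (B + D * t))) / (A + B * t).
    by field.
  rewrite divr_gt0 // ltr_wpDr //.
    by rewrite mulr_ge0 ?(admissible_sum_ge0 adm) //; case/andP: hx => /ltW.
  by rewrite mulr_gt0 // subr_gt0; case/andP: hx.
Qed.

(** * Integrals of 1 / (1 + x y)^2 over segments and rays *)

Lemma is_derive_primitive (R : realType) (x y : R) :
  x != 0 -> 1 + x * y != 0 ->
  is_derive y 1 (fun y : R => - x^-1 * (1 + x * y)^-1)
    (1 / (1 + x * y) ^+ 2).
Proof.
move=> x0 h.
have du : is_derive y 1 (fun y : R => 1 + x * y) x.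
  by apply: is_derive_eq; rewrite /GRing.scale /=; ring.
have dv : is_derive y 1 (fun y : R => (1 + x * y)^-1) (- (1 + x * y) ^- 2 *: x).
  apply: DeriveDef; first by apply: derivableV.
  by rewrite deriveV // derive_val.
apply: is_derive_eq; rewrite /GRing.scale /=.
by field; rewrite x0 h.
Qed.

Lemma continuous_inv_sqr_affine (R : realType) (x y : R) :
  1 + x * y != 0 ->
  {for y, continuous (fun y : R => 1 / (1 + x * y) ^+ 2)}.
Proof.
move=> h; apply: cvgM; first exact: cvg_cst.
apply: cvgV; first by rewrite sqrf_eq0.
have c : ((1 + x * z) @[z --> y] --> 1 + x * y)%classic.
  by apply: cvgD; [exact: cvg_cst | apply: cvgM; [exact: cvg_cst | exact: cvg_id]].
by rewrite expr2; apply: cvgM.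
Qed.

Lemma continuous_primitive (R : realType) (x y : R) :
  x != 0 -> 1 + x * y != 0 ->
  {for y, continuous (fun y : R => - x^-1 * (1 + x * y)^-1)}.
Proof.
move=> x0 h; apply/differentiable_continuous; rewrite -derivable1_diffP.
by have [] := is_derive_primitive x0 h.
Qed.

Lemma primitive_pinfty (R : realType) (x : R) :
  0 < x -> ((- x^-1 * (1 + x * y)^-1) @[y --> +oo] --> (0 : R))%classic.
Proof.
move=> x0; rewrite -[X in (_ --> X)%classic](mulr0 (- x^-1)).
apply: cvgM; first exact: cvg_cst.
apply/gtr0_cvgV0.
  near=> y; rewrite addr_gt0 // mulr_gt0 //; near: y; exact: nbhs_pinfty_gt (num_real _).
apply/cvgryPge => M; near=> y.
have : M / x <= y by near: y; exact: nbhs_pinfty_ge (num_real _).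
by rewrite ler_pdivrMr // mulrC; lra.
Unshelve. all: by end_near. Qed.

Lemma integral_segment (R : realType) (x a b : R) :
  0 < x -> 0 < 1 + x * a -> a < b ->
  (\int[lebesgue_measure]_(y in `[a, b]%classic) (1 / (1 + x * y) ^+ 2)%:E =
   ((b - a) / ((1 + x * a) * (1 + x * b)))%:E)%E.
Proof.
move=> x0 ha ab.
have h y : a <= y -> 0 < 1 + x * y.
  by move=> ay; apply: lt_le_trans ha _; rewrite lerD2l ler_pM2l.
have xn0 := lt0r_neq0 x0.
rewrite (@continuous_FTC2 _ _ (fun y : R => - x^-1 * (1 + x * y)^-1)) //.
- rewrite -EFinB; congr (_%:E); field.
  by rewrite xn0 !lt0r_neq0 // h // ltW.
- apply: continuous_in_subspaceT => y; rewrite inE /= in_itv /= => /andP[ay _].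
  by apply: continuous_inv_sqr_affine; rewrite lt0r_neq0 // h.
- split.
  + move=> y; rewrite in_itv /= => /andP[/ltW ay _].
    by have [] := is_derive_primitive xn0 (lt0r_neq0 (h _ ay)).
  + by apply: cvg_at_right_filter; apply: continuous_primitive; rewrite // lt0r_neq0.
  + apply: cvg_at_left_filter; apply: continuous_primitive => //.
    by rewrite lt0r_neq0 // h // ltW.
- move=> y; rewrite in_itv /= => /andP[/ltW ay _].
  rewrite derive1E.
  have := is_derive_primitive xn0 (lt0r_neq0 (h _ ay)).
  by move=> [_].
Qed.

Lemma integral_ray (R : realType) (x a : R) :
  0 < x -> 0 < 1 + x * a ->
  (\int[lebesgue_measure]_(y in `[a, +oo[%classic) (1 / (1 + x * y) ^+ 2)%:E =
   (1 / (x * (1 + x * a)))%:E)%E.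
Proof.
move=> x0 ha.
have h y : a <= y -> 0 < 1 + x * y.
  by move=> ay; apply: lt_le_trans ha _; rewrite lerD2l ler_pM2l.
have xn0 := lt0r_neq0 x0.
rewrite (@ge0_continuous_FTC2y _ _ (fun y : R => - x^-1 * (1 + x * y)^-1) _ 0) //.
- rewrite -EFinB; congr (_%:E); field.
  by rewrite xn0 !lt0r_neq0.
- by move=> y ay; rewrite divr_ge0 // sqr_ge0.
- apply: continuous_in_subspaceT => y; rewrite inE /= in_itv /= andbT => ay.
  by apply: continuous_inv_sqr_affine; rewrite lt0r_neq0 // h.
- exact: primitive_pinfty.
- by move=> y /ltW ay; have [] := is_derive_primitive xn0 (lt0r_neq0 (h _ ay)).
- by apply: cvg_at_right_filter; apply: continuous_primitive; rewrite // lt0r_neq0.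
- move=> y; rewrite in_itv /= andbT => /ltW ay.
  rewrite derive1E.
  have := is_derive_primitive xn0 (lt0r_neq0 (h _ ay)).
  by move=> [_].
Qed.

(** * The dual set as a projective segment, and the closed form of the density *)

(** The numbers y are the slopes q / p along the segment from (p0, q0) to (p1, q1). Writing the
    upper bound as [y * p1 <= q1] admits [p1 = 0], an endpoint at infinity, where it holds for every
    y. *)
Lemma projective_segmentP (R : realType) (p0 q0 p1 q1 y : R) :
  0 < p0 -> 0 <= p1 -> 0 < p0 * q1 - q0 * p1 ->
  (exists2 t, 0 <= t <= 1 &
     (1 - t) * q0 + t * q1 = y * ((1 - t) * p0 + t * p1)) <->
  q0 / p0 <= y /\ y * p1 <= q1.
Proof.
move=> hp0 hp1 e; rewrite ler_pdivrMr //.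
set g0 := y * p0 - q0; set g1 := q1 - y * p1.
have eg : 0 < p0 * g1 + p1 * g0.
  by move: e; rewrite /g0 /g1; congr (0 < _); ring.
split.
  move=> [t /andP[t0 t1] h].
  have {}h : (1 - t) * g0 = t * g1 by rewrite /g0 /g1; move: h; lra.
  suff : 0 <= g0 /\ 0 <= g1 by rewrite !subr_ge0.
  have [t00|t00] := eqVneq t 0.
    have g00 : g0 = 0 by move: h; rewrite t00; lra.
    split; first by rewrite g00.
    by move: eg; rewrite g00 mulr0 addr0 pmulr_rgt0 // => /ltW.
  have {}t0 : 0 < t by rewrite lt_def t00.
  have k : 0 < ((1 - t) * p0 + t * p1) * g0 -> 0 <= g0 /\ 0 <= g1.
    move=> hk; have hs : 0 <= (1 - t) * p0 + t * p1.
      by rewrite addr_ge0 // mulr_ge0 ?subr_ge0 // ltW.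
    have g00 : 0 < g0.
      by rewrite ltNge; apply/negP => hn; have := mulr_ge0_le0 hs hn; lra.
    split; first exact: ltW.
    by rewrite -(pmulr_rge0 _ t0) -h mulr_ge0 ?(ltW g00) //; lra.
  apply: k.
  have -> : ((1 - t) * p0 + t * p1) * g0 = t * (p0 * g1 + p1 * g0).
    by rewrite mulrDl mulrAC h; ring.
  exact: mulr_gt0.
move=> [h0 h1].
have {}h0 : 0 <= g0 by rewrite subr_ge0.
have {}h1 : 0 <= g1 by rewrite subr_ge0.
have s0 : 0 < g0 + g1.
  rewrite lt_def addr_ge0 // andbT; apply: contraTneq eg => s0.
  have -> : g0 = 0 by lra.
  have -> : g1 = 0 by lra.
  by rewrite !mulr0 addr0 ltxx.
(* The equation for t reads (1 - t) g0 = t g1. *)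
exists (g0 / (g0 + g1)).
  by rewrite divr_ge0 ?(ltW s0) //= ler_pdivrMr // mul1r lerDl.
have n0 := lt0r_neq0 s0; apply/eqP; rewrite -subr_eq0; apply/eqP.
transitivity (g0 / (g0 + g1) * g1 - (1 - g0 / (g0 + g1)) * g0).
  by rewrite /g0 /g1; ring.
by field.
Qed.

Lemma integral_projective_segment (R : realType) (p0 q0 p1 q1 x : R) :
  0 < p0 -> 0 <= p1 -> 0 < p0 * q1 - q0 * p1 -> 0 < x ->
  0 < p0 + q0 * x -> 0 < p1 + q1 * x ->
  (\int[lebesgue_measure]_(y in
       [set y : R | (q0 / p0 <= y)%R /\ (y * p1 <= q1)%R]%classic)
     (1 / (1 + x * y) ^+ 2)%:E =
   ((p0 * q1 - q0 * p1) / ((p0 + q0 * x) * (p1 + q1 * x)))%:E)%E.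
Proof.
move=> hp0 hp1 e x0 h0 h1; have p0n := lt0r_neq0 hp0.
have ha : 0 < 1 + x * (q0 / p0).
  have -> : 1 + x * (q0 / p0) = (p0 + q0 * x) / p0 by field.
  exact: divr_gt0.
have [p10|p1n] := eqVneq p1 0.
  have q1n : q1 != 0 by apply: contraTneq h1 => ->; rewrite p10 mul0r addr0 ltxx.
  have -> : [set y : R | q0 / p0 <= y /\ y * p1 <= q1]%classic =
      `[q0 / p0, +oo[%classic.
    apply/seteqP; split => y /=; rewrite in_itv /= andbT; first by case.
    move=> hy; split=> //; rewrite p10 mulr0.
    by move: h1; rewrite p10 add0r pmulr_lgt0 // => /ltW.
  rewrite integral_ray //; congr (_%:E); rewrite p10; field.
  by rewrite (lt0r_neq0 x0) q1n p0n lt0r_neq0.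
have hp1' : 0 < p1 by rewrite lt_def p1n.
have -> : [set y : R | q0 / p0 <= y /\ y * p1 <= q1]%classic =
    `[q0 / p0, q1 / p1]%classic.
  by apply/seteqP; split => y /=; rewrite in_itv /= -(ler_pdivlMr y q1 hp1') -(rwP andP).
rewrite integral_segment //.
  congr (_%:E); field.
  by rewrite !lt0r_neq0.
by rewrite ltr_pdivlMr // mulrAC ltr_pdivrMr //; lra.
Qed.

(** The sign of A D - B^2 decides the shape: [psi] increases, decreases or is constant. In the
    constant case the two linear factors are proportional; otherwise the integral runs over the
    projective segment with endpoints (A, B) and (A + B, B + D). *)
Lemma admissible_density (R : realType) (A B D : R) :
  admissible A B D ->
  exists2 c, 0 < c & forall x, 0 < x < 1 ->
    dual_density A B D x =
    (c / ((A + B * x) * (A + B + (B + D) * x)))%:E.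
Proof.
move=> adm; have [h0 h1 h2 h3 h4] := adm.
have pgt0 x : 0 < x < 1 -> 0 < A + B * x by apply: affine_gt0.
have qgt0 x : 0 < x < 1 -> 0 < A + B + (B + D) * x.
  by apply: affine_gt0 => //; lra.
have [e|e] := eqVneq (A * D) (B ^+ 2).
  have A0 : 0 < A.
    rewrite lt_def h0 andbT; apply: contraTneq h3 => A0.
    have -> : B = 0 by apply/eqP; rewrite -sqrf_eq0 -e A0 mul0r.
    by rewrite A0 mulr0 addr0 ltxx.
  have An := lt0r_neq0 A0.
  have ED : D = B ^+ 2 / A by rewrite -e; field.
  have E x : A + B + (B + D) * x = (A + B) / A * (A + B * x).
    by rewrite ED; field.
  have AB : 0 < A + B.
    rewrite lt_def h1 andbT; apply/eqP => AB.
    have := qgt0 (1 / 2) ltac:(apply/andP; split; lra).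
    by rewrite E AB !mul0r ltxx.
  exists (A * (A + B)); first exact: mulr_gt0.
  move=> x hx; rewrite /dual_density e eqxx E; congr (_%:E).
  have hp := lt0r_neq0 (pgt0 _ hx).
  by field; rewrite An hp lt0r_neq0.
exists `|A * D - B ^+ 2|; first by rewrite normr_gt0 subr_eq0.
move=> x hx; rewrite /dual_density (negPf e).
have x0 : 0 < x by case/andP: hx.
have [d0|d0] := ltP 0 (A * D - B ^+ 2).
  have A0 : 0 < A.
    rewrite lt_def h0 andbT; apply: contraTneq d0 => ->.
    by rewrite mul0r sub0r oppr_gt0 -leNgt sqr_ge0.
  have dE : A * D - B ^+ 2 = A * (B + D) - B * (A + B) by ring.
  rewrite gtr0_norm // dE -integral_projective_segment ?pgt0 ?qgt0 -?dE //.
  congr (integral _ _ _); apply/seteqP.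
  split=> y /=; rewrite dual_set_finP // -projective_segmentP -?dE //;
    move=> [t ht h]; exists t => //; move: h; lra.
have d1 : 0 < B ^+ 2 - A * D.
  by rewrite lt_def subr_eq0 eq_sym e /=; lra.
have AB : 0 < A + B.
  rewrite lt_def h1 andbT; apply: contraTneq d1 => AB.
  have -> : B = - A by lra.
  rewrite -leNgt sqrrN expr2 -mulrBr mulr_ge0_le0 //; lra.
(* Here [psi] decreases, so the segment is traversed from (A + B, B + D) to (A, B), and t becomes 1
   - t. *)
have dE : B ^+ 2 - A * D = (A + B) * B - (B + D) * A by ring.
rewrite ler0_norm // opprB dE [X in _ / X]mulrC.
rewrite -integral_projective_segment ?pgt0 ?qgt0 -?dE //.
congr (integral _ _ _); apply/seteqP.
split=> y /=; rewrite dual_set_finP // -projective_segmentP -?dE //;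
  move=> [t ht h]; (exists (1 - t);
    [case/andP: ht => ht0 ht1; apply/andP; split; lra | move: h; lra]).
Qed.

(** * The linear systems for T and S123 and their solutions *)

Lemma forall_I3 (P : 'I_3 -> Prop) : (forall j, P j) <-> [/\ P 0, P 1 & P 2].
Proof.
split=> [h|[h0 h1 h2] j]; first by split.
have : j \in enum 'I_3 by rewrite mem_enum.
rewrite enum_ordSl enum_ordSl enum_ordSl !inE.
case/or4P; last by rewrite enum_ord0.
- by move/eqP->.
- by move/eqP->; congr (P _) : h1; apply/val_inj.
- by move/eqP->; congr (P _) : h2; apply/val_inj.
Qed.

Lemma symmetrizes_VP (R : realType) (A B D lambda mu nu : R) :
  (forall j, symmetrizes A B D (V lambda mu nu j)) <->
  [/\ A * (3 * lambda - 3) + B * lambda = B * 3,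
      A * (3 * mu - 9) + B * (2 * mu - 3) = B * 9 + D * 3 &
      A * (nu - 3) + B * (nu - 2) = B * 3 + D * 2].
Proof.
by rewrite forall_I3 /symmetrizes /V /= !mxE /= !mulr0 !addr0.
Qed.

Lemma symmetrizes_WP (R : realType) (A B D lambda mu nu : R) :
  (forall j, symmetrizes A B D (W lambda mu nu j)) <->
  [/\ A * (3 - 3 * lambda) + B * (- lambda) = B * (3 * lambda) + D * lambda,
      A * (9 - 3 * mu) + B * (3 - 2 * mu) = B * (3 * mu) + D * (2 * mu) &
      A * (3 - nu) + B * (2 - nu) = B * nu + D * nu].
Proof.
by rewrite forall_I3 /symmetrizes /W /= !mxE /=.
Qed.

(** The equations of the first and third branch determine (A, B, D) up to k; the second one is then
    k times the stated condition. *)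
Lemma natural_dual_of_T (R : realType) (T : R -> R)
  (X : 'I_3 -> 'M[R]_2) (A B D lambda mu nu : R) :
  0 < lambda -> inverse_branches T (V lambda mu nu) ->
  inverse_branches T X -> natural_dual X A B D ->
  lambda * mu + mu = lambda * nu + 3 * lambda /\
  exists2 k, k != 0 & [/\ A = k * (3 - lambda), B = k * (3 * lambda - 3) &
    D = k * (lambda * nu - 6 * lambda + 3)].
Proof.
move=> l0 hV hX hd; have [nz _ _ _] := hd.
have [|e0 e1 e2] := (symmetrizes_VP A B D lambda mu nu).1.
  move=> j; apply: (symmetrizes_branch hX hV).
  exact: natural_dual_symmetrizes hX hd.
(* The normalized solution has A + B = 2 lambda, so k is obtained without dividing by 3 - lambda,
   which may vanish. *)
have ln := lt0r_neq0 l0; set k := (A + B) / (2 * lambda).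
have kE : 2 * lambda * k = A + B by rewrite /k; field.
have EA : A = k * (3 - lambda).
  apply: (mulfI ln); have : 2 * lambda * k * (3 - lambda) = (A + B) * (3 - lambda).
    by rewrite kE.
  lra.
have EB : B = k * (3 * lambda - 3) by lra.
have ED : D = k * (lambda * nu - 6 * lambda + 3).
  by move: e2; rewrite EA EB; lra.
have k0 : k != 0.
  by apply/eqP => k0; apply: nz; rewrite EA EB ED k0 !mul0r.
split; last by exists k.
apply: (mulfI k0); move: e1; rewrite EA EB ED; lra.
Qed.

Lemma natural_dual_of_S (R : realType) (S : R -> R)
  (X : 'I_3 -> 'M[R]_2) (A B D lambda mu nu : R) :
  0 < lambda -> 0 < nu -> inverse_branches S (W lambda mu nu) ->
  inverse_branches S X -> natural_dual X A B D ->
  lambda * mu - 4 * lambda * nu + mu * nu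
    - 3 * lambda + 4 * mu - 3 * nu = 0 /\
  exists2 k, k != 0 & [/\ A = k * (2 * lambda * (1 + nu)),
    B = k * (3 * nu - 3 * lambda - 2 * lambda * nu) &
    D = k * (6 - 6 * nu + 6 * lambda + 2 * lambda * nu)].
Proof.
move=> l0 n0 hV hX hd; have [nz _ _ _] := hd.
have [|e0 e1 e2] := (symmetrizes_WP A B D lambda mu nu).1.
  move=> j; apply: (symmetrizes_branch hX hV).
  exact: natural_dual_symmetrizes hX hd.
have ln := lt0r_neq0 l0; have n1 : 1 + nu != 0 by apply: lt0r_neq0; lra.
set k := A / (2 * lambda * (1 + nu)).
have EA : A = k * (2 * lambda * (1 + nu)) by rewrite /k; field; rewrite ln n1.
have EB : B = k * (3 * nu - 3 * lambda - 2 * lambda * nu).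
  apply: (@mulfI _ (2 * lambda * (1 + nu))); first by rewrite !mulf_neq0.
  (* This combination of the third and first equations eliminates D. *)
  have : lambda * (A * (3 - nu) + B * (2 - nu)) -
    nu * (A * (3 - 3 * lambda) + B * (- lambda)) =
    lambda * (B * nu + D * nu) - nu * (B * (3 * lambda) + D * lambda).
    by rewrite e0 e2.
  by rewrite EA; lra.
have ED : D = k * (6 - 6 * nu + 6 * lambda + 2 * lambda * nu).
  by apply: (mulfI ln); move: e0; rewrite EA EB; lra.
have k0 : k != 0.
  by apply/eqP => k0; apply: nz; rewrite EA EB ED k0 !mul0r.
split; last by exists k.
apply: (mulfI k0); move: e1; rewrite EA EB ED; lra.
Qed.

(** The corner values are 3 - lambda, 2 lambda (twice) and lambda (nu - 1), which is where the
    bounds on lambda and nu enter. *)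
Lemma admissible_T (R : realType) (lambda nu : R) :
  0 < lambda -> lambda <= 3 -> 1 <= nu ->
  admissible (3 - lambda) (3 * lambda - 3) (lambda * nu - 6 * lambda + 3).
Proof.
move=> l0 l3 n1.
have : 0 <= lambda * (nu - 1) by rewrite mulr_ge0 ?subr_ge0 // ltW.
by rewrite mulrBr mulr1 => h; split; lra.
Qed.

(** The corner values are 2 lambda (1 + nu), 3 nu - lambda (twice) and 6 + 2 lambda. *)
Lemma admissible_S (R : realType) (lambda nu : R) :
  0 < lambda -> lambda <= 3 -> 1 <= nu ->
  admissible (2 * lambda * (1 + nu)) (3 * nu - 3 * lambda - 2 * lambda * nu)
    (6 - 6 * nu + 6 * lambda + 2 * lambda * nu).
Proof.
move=> l0 l3 n1.
have : 0 <= lambda * (nu - 1) by rewrite mulr_ge0 ?subr_ge0 // ltW.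
by rewrite mulrBr mulr1 => h; split; lra.
Qed.

Lemma natural_dual_T (R : realType) (T : R -> R) (lambda mu nu : R) :
  0 < lambda -> lambda <= 3 -> 1 <= nu ->
  inverse_branches T (V lambda mu nu) ->
  lambda * mu + mu = lambda * nu + 3 * lambda ->
  natural_dual (V lambda mu nu)
    (3 - lambda) (3 * lambda - 3) (lambda * nu - 6 * lambda + 3).
Proof.
move=> l0 l3 n1 hT c1; apply: (natural_dual_admissible hT).
  exact: admissible_T.
by apply/symmetrizes_VP; split; lra.
Qed.

Lemma natural_dual_S (R : realType) (S : R -> R) (lambda mu nu : R) :
  0 < lambda -> lambda <= 3 -> 1 <= nu ->
  inverse_branches S (W lambda mu nu) ->
  lambda * mu - 4 * lambda * nu + mu * nu
    - 3 * lambda + 4 * mu - 3 * nu = 0 ->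
  natural_dual (W lambda mu nu) (2 * lambda * (1 + nu))
    (3 * nu - 3 * lambda - 2 * lambda * nu)
    (6 - 6 * nu + 6 * lambda + 2 * lambda * nu).
Proof.
move=> l0 l3 n1 hS c2; apply: (natural_dual_admissible hS).
  exact: admissible_S.
by apply/symmetrizes_WP; split; lra.
Qed.

(** * Comparison of the two densities *)

Lemma admissible_den_gt0 (R : realType) (A B D x : R) :
  admissible A B D -> 0 < x < 1 ->
  0 < (A + B * x) * (A + B + (B + D) * x).
Proof.
move=> [h0 h1 h2 h3 h4] hx.
by rewrite mulr_gt0 // affine_gt0 //; lra.
Qed.

(** The conclusion compares the denominators at x = 0 and x = 1. The densities may be infinite
    there, so the proof compares coefficients of quadratics on the open interval. *)
Lemma dual_density_proportional (R : realType) (A B D A' B' D' c : R) :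
  admissible A B D -> admissible A' B' D' -> 0 < c ->
  (forall x, 0 < x < 1 ->
     dual_density A B D x = (c%:E * dual_density A' B' D' x)%E) ->
  exists2 r, 0 < r &
    A' * (A' + B') = r * (A * (A + B)) /\
    (A' + B') * (A' + 2 * B' + D') = r * ((A + B) * (A + 2 * B + D)).
Proof.
move=> adm adm' c0 e.
have [u u0 hu] := admissible_density adm.
have [v v0 hv] := admissible_density adm'.
have un := lt0r_neq0 u0.
exists (c * v / u); first by rewrite divr_gt0 // mulr_gt0.
have [] := @quadratic_eq0 R
  (u * (A' * (A' + B')) - c * v * (A * (A + B)))
  (u * (A' * (B' + D') + B' * (A' + B'))
   - c * v * (A * (B + D) + B * (A + B)))
  (u * (B' * (B' + D')) - c * v * (B * (B + D))).
  move=> x hx; have := e x hx; rewrite hu // hv // -EFinM => -[].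
  have := lt0r_neq0 (admissible_den_gt0 adm hx).
  have := lt0r_neq0 (admissible_den_gt0 adm' hx).
  move=> p' p /eqP; rewrite (mulrA c v) eqr_div // => /eqP.
  by move/eqP; rewrite -subr_eq0 => /eqP <-; ring.
move=> E0 E1 E2.
have rE y : u * (c * v / u * y) = c * v * y by field.
by split; apply: (mulfI un); rewrite rE; lra.
Qed.

Unset Implicit Arguments.
Set Strict Implicit.

Theorem theorem3 (R : realType) (lambda mu nu : R) (T S123 : R -> R)
  (hlambda0 : 0 < lambda) (hlambda3 : lambda <= 3) (hmu : 0 < mu)
  (hnu : 1 <= nu)
  (hT : inverse_branches T (V lambda mu nu))
  (hS123 : inverse_branches S123 (W lambda mu nu)) :
  [/\ has_natural_dual T <->
        lambda * mu + mu = lambda * nu + 3 * lambda,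
      has_natural_dual S123 <->
        lambda * mu - 4 * lambda * nu + mu * nu
          - 3 * lambda + 4 * mu - 3 * nu = 0 &
      lambda * mu + mu = lambda * nu + 3 * lambda ->
      lambda * mu - 4 * lambda * nu + mu * nu
        - 3 * lambda + 4 * mu - 3 * nu = 0 ->
      (same_invariant_measure T S123 <-> mu = 3 /\ lambda * nu = 3)].
Proof.
have nu0 : 0 < nu by lra.
have ln := lt0r_neq0 hlambda0.
split.
- split=> [[X [A [B [D [hX hd]]]]]|c1].
    by have [] := natural_dual_of_T hlambda0 hT hX hd.
  by do 4!eexists; split; [exact: hT | exact: natural_dual_T hT c1].
- split=> [[X [A [B [D [hX hd]]]]]|c2].
    by have [] := natural_dual_of_S hlambda0 nu0 hS123 hX hd.
  by do 4!eexists; split; [exact: hS123 | exact: natural_dual_S hS123 c2].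
move=> c1 c2.
have aT := admissible_T hlambda0 hlambda3 hnu.
have aS := admissible_S hlambda0 hlambda3 hnu.
have [cT cT0 hTd] := admissible_density aT.
have [cS cS0 hSd] := admissible_density aS.
split.
  move=> [h [k [[X [A [B [D [hX hXd ->]]]]] [Y [A' [B' [D' [hY hYd ->]]]]]]]].
  have [_ [u u0 [-> -> ->]]] := natural_dual_of_T hlambda0 hT hX hXd.
  have [_ [v v0 [-> -> ->]]] := natural_dual_of_S hlambda0 nu0 hS123 hY hYd.
  rewrite !dual_density_scale // => -[c c0 e].
  (* Then the first condition reads (lambda + 1) mu = 3 (lambda + 1). *)
  suff ln3 : lambda * nu = 3.
    split=> //; have l1 : lambda + 1 != 0 by apply: lt0r_neq0; lra.
    by apply: (mulfI l1); lra.
  (* The factor lambda + 1 turns every mu of the second condition into (lambda + 1) mu, which the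
     first condition replaces. *)
  have factor : (lambda * nu - 3) * (nu - 3 * lambda) = 0.
    have : (lambda + 1) * (lambda * mu - 4 * lambda * nu + mu * nu
        - 3 * lambda + 4 * mu - 3 * nu) = 0 by rewrite c2 mulr0.
    have -> : (lambda + 1) * (lambda * mu - 4 * lambda * nu + mu * nu
        - 3 * lambda + 4 * mu - 3 * nu) =
      (lambda * mu + mu) * (lambda + nu + 4) -
      (lambda + 1) * (4 * lambda * nu + 3 * lambda + 3 * nu) by ring.
    by rewrite c1 => <-; ring.
  move/eqP: factor; rewrite mulf_eq0 !subr_eq0 => /orP[/eqP //|/eqP nuE].
  have [r r0] := dual_density_proportional aT aS c0 e.
  rewrite nuE => -[E0 E1].
  have q0 : 288 * lambda ^+ 2 * r != 0.
    by rewrite !mulf_neq0 ?expf_neq0 ?(lt0r_neq0 r0) ?pnatr_eq0.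
  (* Cross-multiplying [E0] and [E1] leaves 288 lambda^2 r (lambda^4 - 1) = 0. *)
  have l4 : lambda ^+ 4 = 1.
    apply: (mulfI q0); apply/eqP; rewrite -subr_eq0; apply/eqP.
    set p0 := (X in X = _) in E0; set p1 := (X in X = _) in E1.
    transitivity (p0 * (r * ((3 - lambda + (3 * lambda - 3)) *
      (3 - lambda + 2 * (3 * lambda - 3) + (lambda * (3 * lambda) - 6 * lambda + 3)))) -
      r * ((3 - lambda) * (3 - lambda + (3 * lambda - 3))) * p1).
      by rewrite /p0 /p1; ring.
    by rewrite -E1 -E0 subrr.
  have -> : lambda = 1 by apply/eqP; rewrite -(@pexpr_eq1 _ _ 4) ?l4 // ltW.
  by lra.
move=> [_ ln3].
do 2!eexists; split.
- by do 4!eexists; split; [exact: hT | exact: natural_dual_T hT c1 |].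
- by do 4!eexists; split; [exact: hS123 | exact: natural_dual_S hS123 c2 |].
(* For lambda nu = 3 the linear factors of the denominator for S123 are those for T, interchanged
   and each multiplied by (lambda + 3) / lambda. *)
exists (cT / cS * ((lambda + 3) / lambda) ^+ 2).
  by rewrite mulr_gt0 ?divr_gt0 // exprn_gt0 // divr_gt0 //; lra.
move=> x hx; rewrite hTd // hSd // -EFinM; congr (_%:E).
have nuE : nu = 3 / lambda by rewrite -ln3; field.
have := lt0r_neq0 (admissible_den_gt0 aT hx).
have := lt0r_neq0 (admissible_den_gt0 aS hx).
have l3 : lambda + 3 != 0 by apply: lt0r_neq0; lra.
have cS1 := lt0r_neq0 cS0.
set pS := (X in X != 0 -> _ -> _); set pT := (X in _ -> X != 0 -> _) => pS0 pT0.
have pE : pS = ((lambda + 3) / lambda) ^+ 2 * pT.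
  by rewrite /pS /pT nuE; field.
change (cT / pT = cT / cS * ((lambda + 3) / lambda) ^+ 2 * (cS / pS)).
by rewrite pE in pS0 *; field; rewrite pT0 cS1 l3 ln.
Qed.
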